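(* Let $A$ be an $m\times n$ integer matrix such that every row except possibly the first has its minimum attained at least twice (so at most the first row has a strict minimum). Run the lifting phase of Grigoriev's algorithm on $A$: while the first row has a strict minimum, perform a lifting (returning ''infeasible'' if lifting is impossible). Then Grigoriev's algorithm finds the componentwise smallest nonnegative solution of the system; equivalently, the matrix it outputs is the smallest solution matrix that is (componentwise) greater than or equal to $A$, i.e. it equals $A+x$ (adding $x_j$ to column $j$) where $x$ is the componentwise smallest vector with $x\ge 0$ that is a solution of $A$.
   Context: A tropical linear system is given by an $m\times n$ integer matrix $A=(a_{ij})$. A solution is a row $x=(x_1,\dots,x_n)$ such that for every row $i$ the minimum $\min_j(a_{ij}+x_j)$ is attained at least twice; a minimum attained at exactly one column is called a strict minimum. A solution matrix is a matrix obtained from $A$ by adding constants to columns (and rows) for which the zero row is a solution, i.e. no row has a strict minimum. Solutions are partially ordered componentwise. Lifting (Grigoriev): let $i$ be the column of the first row's strict minimum. Set $J=\{i\}$; while there is a row whose set of minimum positions contains exactly one column $j\notin J$, add $j$ to $J$ (the resulting set $J$ is the unique inclusion-maximal such set). If $|J|=n$, lifting is impossible. Otherwise let $a$ be the largest number that can be added to all columns indexed by $J$ such that in every row the minimal elements remain minimal (i.e. the minimum over rows whose minima lie only in $J$ of the gap between the row minimum and the smallest entry of that row outside $J$), and add $a$ to every column in $J$. *)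

(* Defs.v *)
From HB Require Import structures.
From mathcomp Require Import all_boot all_order all_algebra.

Set Implicit Arguments.
Unset Strict Implicit.
Unset Printing Implicit Defensive.

Import Order.TTheory GRing.Theory Num.Theory.
Local Open Scope ring_scope.

(* Dimensions are m.+1 and n.+1 so that the first row and row minima exist. *)

(* The minimum of F over P; the value is 0 (junk) when P is empty. *)
Definition fin_min (I : finType) (P : pred I) (F : I -> int) : int :=
  if [pick i | P i] is Some i0 then \big[Num.min/F i0]_(i | P i) F i else 0.

Section Tropical.

Variables m n : nat.
Implicit Types (A B : 'M[int]_(m.+1, n.+1)) (x : 'rV[int]_n.+1).
Implicit Types (y : 'cV[int]_m.+1) (J : {set 'I_n.+1}).

Definition row_min A (i : 'I_m.+1) : int := fin_min predT (A i).

Definition min_set A (i : 'I_m.+1) : {set 'I_n.+1} :=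
  [set j | A i j == row_min A i].

Definition min_attained_twice A i : bool := (1 < #|min_set A i|)%N.

Definition strict_min A i : bool := #|min_set A i| == 1%N.

Definition add_cols A x : 'M[int]_(m.+1, n.+1) :=
  \matrix_(i, j) (A i j + x 0 j).

Definition add_rows A y : 'M[int]_(m.+1, n.+1) :=
  \matrix_(i, j) (A i j + y i 0).

Definition is_solution A x : Prop :=
  forall i, min_attained_twice (add_cols A x) i.

Definition is_solution_matrix A B : Prop :=
  (exists x y, B = add_rows (add_cols A x) y) /\ is_solution B 0.

Definition grow A J : {set 'I_n.+1} :=
  if [pick j | [exists i, min_set A i :\: J == [set j]]] is Some j
  then j |: J else J.

(* When the first row has a strict minimum, the starting set min_set A ord0 is *)
(* the singleton of its column.  Each effective step adds one column, so n.+1  *)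
(* steps exhaust the loop; the final set does not depend on the order in which *)
(* the columns are picked.                                                     *)
Definition lift_set A : {set 'I_n.+1} :=
  iter n.+1 (grow A) (min_set A ord0).

Definition gap A J (i : 'I_m.+1) : int :=
  fin_min (fun j => j \notin J) (A i) - row_min A i.

(* Both minima are over nonempty families when the first row has a strict      *)
(* minimum and J = lift_set A is not full: row 0 qualifies.                    *)
Definition lift_amount A J : int :=
  fin_min (fun i => min_set A i \subset J) (gap A J).

Definition lifting A : option 'M[int]_(m.+1, n.+1) :=
  let J := lift_set A in
  if #|J| == n.+1 then None
  else Some (add_cols A (\row_j (if j \in J then lift_amount A J else 0))).

(* lifting_phase A out: the loop started on A terminates and returns out, None *)
(* standing for "infeasible"; out is uniquely determined by A.                 *)
Inductive lifting_phase A : option 'M[int]_(m.+1, n.+1) -> Prop :=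
| Phase_stop : ~~ strict_min A ord0 -> lifting_phase A (Some A)
| Phase_infeasible :
    strict_min A ord0 -> lifting A = None -> lifting_phase A None
| Phase_lift B out :
    strict_min A ord0 -> lifting A = Some B -> lifting_phase B out ->
    lifting_phase A out.

End Tropical.

Definition mx_le (p q : nat) (M N : 'M[int]_(p, q)) : Prop :=
  forall i j, M i j <= N i j.

Definition is_smallest (p q : nat) (P : 'M[int]_(p, q) -> Prop)
    (M : 'M[int]_(p, q)) : Prop :=
  P M /\ forall N, P N -> mx_le M N.

Definition smallest_nonneg_solution (m n : nat) (A : 'M[int]_(m.+1, n.+1))
    (x : 'rV[int]_n.+1) : Prop :=
  is_smallest (fun z : 'rV[int]_n.+1 => mx_le 0 z /\ is_solution A z) x.

Definition smallest_solution_matrix_above (m n : nat)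
    (A B : 'M[int]_(m.+1, n.+1)) : Prop :=
  is_smallest (fun C => is_solution_matrix A C /\ mx_le A C) B.

(* Main.v *)
(* Let a strict first row have its minimum in column c, let J be the lift set  *)
(* and a the lift amount.  If a nonnegative solution z had minimum v < a over  *)
(* J, no column of J where z equals v could be the first one to enter J: the   *)
(* row responsible for its entry would get a strict minimum in A + z.  So z    *)
(* is at least a on J, and lifting loses no nonnegative solution.  If J is     *)
(* full the same argument, with v the minimum of z, excludes every solution.   *)
(* The first row keeps its minimum in column c, which is raised at each        *)
(* lifting, while some column is not; hence the nonnegative sum of the         *)
(* differences between the first row and its minimum decreases strictly, and   *)
(* the phase terminates.                                                       *)
Require Import Defs.
From HB Require Import structures.
From mathcomp Require Import all_boot all_order all_algebra zify.

Set Implicit Arguments.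
Unset Strict Implicit.
Unset Printing Implicit Defensive.

Import Order.TTheory GRing.Theory Num.Theory.
Local Open Scope ring_scope.

(** Each lifting is a translation by [lift_row A], and solving commutes with translation. By
    [lift_row_le] every nonnegative solution dominates [lift_row A], so subtracting it turns
    nonnegative solutions of [A] into those of the lifted matrix, and smallest solutions correspond.
    Rows with two minima keep two ([min_attained_twice_lift]), so when the first row stops being
    strict, 0 is the smallest nonnegative solution. The lower bound and infeasibility both rest on
    [solution_gt_on_lift_set]; termination rests on [excess_lift]. *)

Section FinMin.

Variables (I : finType) (P : pred I) (F : I -> int).

Lemma fin_min_le i : P i -> fin_min P F <= F i.
Proof.
rewrite /fin_min => Pi; case: pickP => [i0 _|/(_ i)]; last by rewrite Pi.
by rewrite (bigD1 i) //= ge_min lexx.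
Qed.

Lemma fin_min_mem i : P i -> exists2 k, P k & fin_min P F = F k.
Proof.
rewrite /fin_min => Pi; case: pickP => [i0 Pi0|/(_ i)]; last by rewrite Pi.
elim/big_ind: _ => [|x y [k Pk ->] [l Pl ->]|k Pk]; first by exists i0.
  by rewrite minEle; case: ifP => _; [exists k | exists l].
by exists k.
Qed.

End FinMin.

Section Lifting.

Variables m n : nat.
Implicit Types (A B : 'M[int]_(m.+1, n.+1)) (x y z : 'rV[int]_n.+1).
Implicit Types (J : {set 'I_n.+1}) (i : 'I_m.+1).

(** * Row minima and translation of solutions *)

Lemma row_min_le A i j : row_min A i <= A i j.
Proof. exact: fin_min_le. Qed.

Lemma min_setP A i j : reflect (forall k, A i j <= A i k) (j \in min_set A i).
Proof.
rewrite inE; apply: (iffP eqP) => [-> k|Hj]; first exact: row_min_le.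
apply/eqP; rewrite eq_le row_min_le andbT.
by have [k _ Hk] := @fin_min_mem _ predT (A i) ord0 isT;
  rewrite /row_min Hk.
Qed.

Lemma min_setE A i j : j \in min_set A i -> A i j = row_min A i.
Proof. by rewrite inE => /eqP. Qed.

Lemma min_set_gt0 A i : (0 < #|min_set A i|)%N.
Proof.
have [k _ Hk] := @fin_min_mem _ predT (A i) ord0 isT.
by apply/card_gt0P; exists k; rewrite inE /row_min Hk.
Qed.

Lemma add_colsA A x z : add_cols (add_cols A x) z = add_cols A (x + z).
Proof. by apply/matrixP => i j; rewrite !mxE addrA. Qed.

Lemma add_cols0 A : add_cols A 0 = A.
Proof. by apply/matrixP => i j; rewrite !mxE addr0. Qed.

Lemma mx_le0D x z : mx_le 0 x -> mx_le 0 z -> mx_le 0 (x + z).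
Proof.
move=> Hx Hz i j; have := Hx i j; have := Hz i j; rewrite !mxE => ? ?.
exact: addr_ge0.
Qed.

Lemma mx_le_subr x y z : mx_le y (z - x) <-> mx_le (x + y) z.
Proof. by split=> H i j; have := H i j; rewrite !mxE lerBrDl. Qed.

Lemma is_solution_add_cols A x z :
  is_solution (add_cols A x) z <-> is_solution A (x + z).
Proof. by rewrite /is_solution add_colsA. Qed.

(** Raising all columns by the same constant moves no minimum position. *)
Lemma is_solution_shift A x z (c : int) :
  (forall j, z 0 j = x 0 j + c) -> is_solution A x -> is_solution A z.
Proof.
move=> Hz Hx i; apply: leq_trans (Hx i) (subset_leq_card _).
apply/subsetP => j /min_setP Hj; apply/min_setP => k.
by move: (Hj k); rewrite !mxE !Hz; lia.
Qed.

(** * The lift set as a fixed point of growth *)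

Lemma sub_grow A J : J \subset grow A J.
Proof. by rewrite /grow; case: pickP => // j _; apply: subsetUr. Qed.

Lemma sub_iter_grow A J s t : (s <= t)%N ->
  iter s (grow A) J \subset iter t (grow A) J.
Proof.
move=> /subnK <-; elim: (t - s)%N => //= d; move/subset_trans; apply.
exact: sub_grow.
Qed.

Lemma min_set_sub_lift_set A : min_set A ord0 \subset lift_set A.
Proof. exact: (@sub_iter_grow A _ 0 n.+1). Qed.

Lemma grow_fixed A J i :
  grow A J = J -> ~~ (min_set A i \subset J) -> (1 < #|min_set A i :\: J|)%N.
Proof.
rewrite /grow; case: pickP => [j /existsP[i' /eqP Hj] HJ|Hn _ nsub].
  have: j \in min_set A i' :\: J by rewrite Hj set11.
  by rewrite inE -HJ setU11.
have: (0 < #|min_set A i :\: J|)%N by rewrite card_gt0 setD_eq0.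
rewrite leq_eqVlt => /orP[|//]; rewrite eq_sym => /cards1P[j Hj].
by move: (Hn j) => /existsP[]; exists i; rewrite Hj.
Qed.

(** A growth step that changes the set adds a column, so before stabilizing the set has more than
    [t] elements after [t] steps; at [t = n.+1] this exceeds the number of columns. *)
Lemma grow_lift_set A : grow A (lift_set A) = lift_set A.
Proof.
have H t : let J := iter t (grow A) (min_set A ord0) in
    grow A J = J \/ (t < #|J|)%N.
  elim: t => [|t] /=; first by right; apply: min_set_gt0.
  set J := iter t _ _ => IH.
  have [E|ne] := eqVneq (grow A J) J; first by left; rewrite !E.
  case: IH => [/eqP|IH]; first by rewrite (negPf ne).
  right; apply: leq_ltn_trans IH (proper_card _).
  by rewrite properEneq eq_sym ne sub_grow.
have [//|] := H n.+1.
by move=> /leq_trans/(_ (max_card _)); rewrite card_ord ltnn.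
Qed.

(** This common core serves two choices of [v], each a minimum of [z] over the lift set: the
    conclusion then contradicts attainment. *)
Lemma solution_gt_on_lift_set A z (v : int) :
  strict_min A ord0 -> is_solution A z ->
  (forall k, k \in lift_set A -> v <= z 0 k) ->
  (forall i l, min_set A i \subset lift_set A -> l \notin lift_set A ->
     row_min A i + v < A i l + z 0 l) ->
  forall k, k \in lift_set A -> v < z 0 k.
Proof.
set J := lift_set A => str sol geJ gtC.
(* In row [i] of [A + z] the minimum is [row_min A i + v], attained at [k]. A second minimal column
   [k'] lies in [J] by [gtC], so both [A i k'] and [z 0 k'] must meet their lower bounds. *)
have twice i k : min_set A i \subset J -> k \in min_set A i -> z 0 k = v ->
    exists2 k', k' \in min_set A i :\ k & z 0 k' = v.
  move=> sub Mk zk; have lows l : row_min A i + v <= A i l + z 0 l.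
    have [lJ|/gtC-/(_ i sub)/ltW//] := boolP (l \in J).
    by apply: lerD (geJ _ lJ); apply: row_min_le.
  have Ak := min_setE Mk.
  have Sk : k \in min_set (add_cols A z) i.
    by apply/min_setP => l; rewrite !mxE zk Ak.
  have := sol i; rewrite /min_attained_twice (cardsD1 k) Sk add1n ltnS.
  case/card_gt0P => k'; rewrite in_setD1 => /andP[ne /min_setP/(_ k)].
  rewrite !mxE Ak zk => le.
  have k'J : k' \in J.
    by apply: contraLR le => /(gtC _ _ sub); rewrite -ltNge.
  have := geJ _ k'J; have := row_min_le A i k'; move=> ? ?.
  exists k'; last by lia.
  by rewrite in_setD1 ne inE /=; apply/eqP; lia.
have str' i k : min_set A i \subset J -> k \in min_set A i ->
    {in min_set A i :\ k, forall l, v < z 0 l} -> v < z 0 k.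
  move=> sub Mk oth; rewrite lt_neqAle geJ ?(subsetP sub) // andbT.
  apply/eqP => /esym /(twice _ _ sub Mk)[l /oth].
  by move=> /[swap] ->; rewrite ltxx.
(* Induction on the stage of growth. The bound on [t] keeps the stage inside [J], where [geJ]
   applies; the row that admits [c] has all its other minima in the previous stage. *)
suff H t : (t <= n.+1)%N ->
    {in iter t (grow A) (min_set A ord0), forall l, v < z 0 l} by exact: (H n.+1).
elim: t => [_ k /= Mk|t IH lt k].
  apply: (str' _ _ (min_set_sub_lift_set A) Mk) => l.
  have [c E] := cards1P str; move: Mk; rewrite E !inE => /eqP ->.
  by case: eqP.
have := @sub_iter_grow A (min_set A ord0) _ _ lt; rewrite -/(lift_set A) -/J /=.
set J' := iter t _ _ in IH *; rewrite /grow; case: pickP => [c|_ _]; last first.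
  by apply: IH; apply: ltnW.
move=> /existsP[i /eqP Mi] sub /setU1P[->|]; last by apply: IH; apply: ltnW.
have Mi' l : l \in min_set A i -> l != c -> l \in J'.
  move=> Ml; apply: contraNT => lJ'.
  have : l \in min_set A i :\: J' by rewrite inE lJ' Ml.
  by rewrite Mi inE.
apply: (str' i).
- apply/subsetP => l Ml; apply: (subsetP sub); rewrite in_setU1.
  by have [//|/(Mi' _ Ml) ->] := eqVneq l c; rewrite orbT.
- by have /setDP[] : c \in min_set A i :\: J' by rewrite Mi set11.
- by move=> l /setD1P[lc Ml]; apply: IH (ltnW lt) _ (Mi' _ Ml lc).
Qed.

Lemma full_lift_set_infeasible A z : strict_min A ord0 ->
  #|lift_set A| = n.+1 -> ~ is_solution A z.
Proof.
move=> str card sol.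
have full l : l \in lift_set A.
  suff -> : lift_set A = setT by rewrite inE.
  by apply/eqP; rewrite eqEcard subsetT cardsT card_ord card /=.
have [k _ Hk] := @fin_min_mem _ predT (z 0) ord0 isT.
suff: z 0 k < z 0 k by rewrite ltxx.
apply: (solution_gt_on_lift_set str sol) (full k) => [l _|i l _].
  by rewrite -Hk; apply: fin_min_le.
by rewrite full.
Qed.

(** * Effect of one lifting *)

Lemma lift_amount_le A i l : min_set A i \subset lift_set A ->
  l \notin lift_set A ->
  row_min A i + lift_amount A (lift_set A) <= A i l.
Proof.
set J := lift_set A => sub nl.
have := @fin_min_le _ (fun i => min_set A i \subset J) (gap A J) _ sub.
have := @fin_min_le _ (fun j => j \notin J) (A i) l nl.
rewrite -/(lift_amount A J) /gap; lia.
Qed.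

(** The column [l] and the first row make both families of minima nonempty, so neither [fin_min]
    takes its default value. *)
Lemma lift_amount_gt0 A l : l \notin lift_set A ->
  0 < lift_amount A (lift_set A).
Proof.
move=> nl; rewrite /lift_amount.
have [i sub ->] := @fin_min_mem _ (fun i => min_set A i \subset lift_set A)
  (gap A (lift_set A)) ord0 (min_set_sub_lift_set A).
have [k nk Hk] := @fin_min_mem _ (fun j => j \notin lift_set A) (A i) l nl.
rewrite /gap Hk subr_gt0 lt_neqAle row_min_le andbT.
by apply: contra nk => /eqP Hm; apply: (subsetP sub); rewrite inE -Hm.
Qed.

Definition lift_row A : 'rV[int]_n.+1 :=
  \row_j (if j \in lift_set A then lift_amount A (lift_set A) else 0).

Lemma lift_row_le A z : strict_min A ord0 -> mx_le 0 z -> is_solution A z ->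
  mx_le (lift_row A) z.
Proof.
move=> str z0 sol o j; rewrite (ord1 o) mxE.
case: ifP => [Jj|_]; last by have := z0 0 j; rewrite mxE.
set P := fun j => j \in lift_set A.
have [k kJ Hk] := @fin_min_mem _ P (z 0) j Jj.
have min_le l : l \in lift_set A -> z 0 k <= z 0 l.
  by move=> lJ; rewrite -Hk; apply: (@fin_min_le _ P).
apply: le_trans (min_le _ Jj); rewrite leNgt; apply/negP => lt.
suff: z 0 k < z 0 k by rewrite ltxx.
(* Outside the lift set [z] is nonnegative and the gap is at least the lift amount, which exceeds
   [z 0 k]. *)
apply: solution_gt_on_lift_set str sol min_le _ _ kJ => i l sub nl.
by have := lift_amount_le sub nl; have := z0 0 l; rewrite mxE; lia.
Qed.

Lemma min_set_lift A i j : min_set A i \subset lift_set A ->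
  j \in min_set A i -> j \in min_set (add_cols A (lift_row A)) i.
Proof.
move=> sub Mj; apply/min_setP => k; rewrite !mxE (subsetP sub) // (min_setE Mj).
case: ifP => [_|/negbT/(lift_amount_le sub)]; last by rewrite addr0.
by rewrite lerD2r row_min_le.
Qed.

(** If all minima of the row lie in the lift set, they rise together and stay minimal. Otherwise at
    least two lie outside; they stay put while no entry decreases. *)
Lemma min_attained_twice_lift A i l : l \notin lift_set A ->
  min_attained_twice A i -> min_attained_twice (add_cols A (lift_row A)) i.
Proof.
rewrite /min_attained_twice => /lift_amount_gt0 a0 tw.
have [sub|nsub] := boolP (min_set A i \subset lift_set A).
  apply: leq_trans tw (subset_leq_card _); apply/subsetP => j.
  exact: min_set_lift.
apply: leq_trans (grow_fixed (grow_lift_set A) nsub) (subset_leq_card _).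
apply/subsetP => j /setDP[/min_setP Mj nj]; apply/min_setP => k; rewrite !mxE.
by have := Mj k; rewrite (negPf nj); case: ifP => _; lia.
Qed.

(** * Termination and the invariant of the phase *)

Definition excess A : int := \sum_k (A ord0 k - row_min A ord0).

Lemma excess_ge0 A : 0 <= excess A.
Proof. by apply: sumr_ge0 => k _; rewrite subr_ge0 row_min_le. Qed.

Lemma excess_lift A l : l \notin lift_set A ->
  excess (add_cols A (lift_row A)) < excess A.
Proof.
move=> nl; have a0 := lift_amount_gt0 nl.
have [j Mj] := card_gt0P (min_set_gt0 A ord0).
have sub := min_set_sub_lift_set A.
(* Measured against the raised minimal column [j], columns of the lift set keep their difference and
   the others, [l] among them, lose the lift amount. *)
rewrite /excess -(min_setE Mj) -(min_setE (min_set_lift sub Mj)).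
rewrite [ltLHS](bigD1 l) //= [ltRHS](bigD1 l) //=.
apply: ltr_leD; first by rewrite !mxE (negPf nl) (subsetP sub) //; lia.
apply: ler_sum => k _; rewrite !mxE (subsetP sub j Mj).
by case: ifP => _; lia.
Qed.

Lemma smallest_nonneg_solution_lift A x : strict_min A ord0 ->
  mx_le 0 (lift_row A) ->
  smallest_nonneg_solution (add_cols A (lift_row A)) x ->
  smallest_nonneg_solution A (lift_row A + x).
Proof.
move=> str l0 [[x0 /is_solution_add_cols sol] min]; split.
  by split=> //; apply: mx_le0D.
move=> z [z0 zsol]; apply/mx_le_subr/min; split.
  by apply/mx_le_subr; rewrite addr0; apply: lift_row_le.
by rewrite is_solution_add_cols addrC subrK.
Qed.

Lemma smallest_solution_matrix_above_add_cols A x :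
  smallest_nonneg_solution A x ->
  smallest_solution_matrix_above A (add_cols A x).
Proof.
case=> [[x0 sol] min]; split.
  split; last by move=> i j; have := x0 0 j; rewrite !mxE; lia.
  split; last by rewrite is_solution_add_cols addr0.
  by exists x, 0; apply/matrixP => i j; rewrite !mxE addr0.
move=> C [[[x' [y ->]] solC] leC] i j.
(* The witness depends on the row [i] under comparison: absorbing [y i 0] into the columns makes [z]
   nonnegative, and as a uniform shift of [x'] it is still a solution. *)
pose z : 'rV[int]_n.+1 := \row_k (x' 0 k + y i 0).
have: mx_le x z.
  apply: min; split=> [o k|].
    by have := leC i k; rewrite !mxE; lia.
  apply: (@is_solution_shift A x' z (y i 0)) => [k|i'].
    by rewrite mxE.
  apply: leq_trans (solC i') (subset_leq_card _).
  apply/subsetP => k /min_setP Hk; apply/min_setP => l.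
  by have := Hk l; rewrite !mxE; lia.
by move=> /(_ 0 j); rewrite !mxE; lia.
Qed.

Lemma lifting_phase_smallest A :
  (forall i, i != ord0 -> min_attained_twice A i) ->
  exists2 out, lifting_phase A out &
    match out with
    | Some B => exists2 x, smallest_nonneg_solution A x & B = add_cols A x
    | None => forall x, ~ is_solution A x
    end.
Proof.
have [N] := ubnP `|excess A|%N; elim: N A => // N IH A ltN hA.
have [str|nstr] := boolP (strict_min A ord0); last first.
  exists (Some A); first exact: Phase_stop.
  exists 0; last by rewrite add_cols0.
  split=> [|z [] //]; split=> [//|i]; rewrite add_cols0.
  have [->|/hA //] := eqVneq i ord0.
  by rewrite /min_attained_twice ltn_neqAle eq_sym nstr min_set_gt0.
have [card|ncard] := eqVneq #|lift_set A| n.+1.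
  exists None; first by apply: Phase_infeasible; rewrite // /lifting card eqxx.
  by move=> x; apply: full_lift_set_infeasible.
have [l nl] : exists l, l \notin lift_set A.
  apply/existsP; apply: contraNT ncard; rewrite negb_exists => /forallP full.
  rewrite -[X in _ == X]card_ord -cardsT; apply/eqP/eq_card => k.
  by have := full k; rewrite inE negbK.
have lift : lifting A = Some (add_cols A (lift_row A)).
  by rewrite /lifting (negPf ncard).
have l0 : mx_le 0 (lift_row A).
  by move=> o j; rewrite !mxE; case: ifP => // _; apply: ltW (lift_amount_gt0 nl).
have [||out phase spec] := IH (add_cols A (lift_row A)).
- have := excess_lift nl; have := excess_ge0 (add_cols A (lift_row A)).
  by have := excess_ge0 A; lia.
- by move=> i /hA; apply: min_attained_twice_lift nl.
exists out; first exact: Phase_lift lift phase.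
case: out spec {phase} => [B [x sx ->]|infeas x sol].
  exists (lift_row A + x); last by rewrite add_colsA.
  exact: smallest_nonneg_solution_lift.
(* Infeasibility excludes solutions of any sign, so the translate need not be nonnegative. *)
by apply: (infeas (x - lift_row A)); rewrite is_solution_add_cols addrC subrK.
Qed.

End Lifting.

Theorem theorem1 (m n : nat) (A : 'M[int]_(m.+1, n.+1))
    (hA : forall i : 'I_m.+1, i != ord0 -> min_attained_twice A i) :
  exists out : option 'M[int]_(m.+1, n.+1),
    lifting_phase A out /\
    match out with
    | Some B =>
        (exists x : 'rV[int]_n.+1,
           smallest_nonneg_solution A x /\ B = add_cols A x) /\
        smallest_solution_matrix_above A B
    | None => forall x : 'rV[int]_n.+1, ~ is_solution A x
    end.
Proof.
have [out phase spec] := lifting_phase_smallest hA; exists out; split=> //.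
case: out spec {phase} => // B [x sx ->]; split; first by exists x.
exact: smallest_solution_matrix_above_add_cols.
Qed.
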